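(* Let $m,n$ be positive integers and let $\mathbf{h}=(h_1,\ldots,h_m)$ and $\mathbf{k}=(k_1,\ldots,k_n)$ be sequences of nonnegative integers. If there exists a convex array $A\in\Phi(m,n;\mathbf{h},\mathbf{k})$, then there exists a $\mathrm{NASM}(m,n;\mathbf{h},\mathbf{k})$.
   Context: The weight of a row (or column) of an integer matrix is the number of its nonzero entries. $\Phi(m,n)$ is the set of all $m\times n$ arrays with entries in $\{0,1\}$ (binary arrays), and $\Psi(m,n)$ is the set of all $m\times n$ arrays with entries in $\{0,1,-1\}$. $\Phi(m,n;\mathbf{h},\mathbf{k})$ (respectively $\Psi(m,n;\mathbf{h},\mathbf{k})$) is the subset of those arrays in which row $i$ has weight $h_i$ for every $i$ and column $j$ has weight $k_j$ for every $j$. A binary array is convex if the ones are consecutive in each row and in each column (no zero lies between two ones in a row or column). An array $A\in\Psi(m,n)$ is a near alternating sign matrix (NASM) if in each row and in each column the nonzero entries alternate in sign (i.e. any two consecutive nonzero entries of a row or column, ignoring zeros, have opposite signs). A $\mathrm{NASM}(m,n;\mathbf{h},\mathbf{k})$ is a NASM belonging to $\Psi(m,n;\mathbf{h},\mathbf{k})$. *)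

(* Defs.v *)
From mathcomp Require Import all_boot all_order all_algebra.

Set Implicit Arguments.
Unset Strict Implicit.
Unset Printing Implicit Defensive.

Import Order.TTheory GRing.Theory Num.Theory.
Local Open Scope ring_scope.

Definition row_weight m n (A : 'M[int]_(m, n)) (i : 'I_m) : nat :=
  #|[set j : 'I_n | A i j != 0]|.

Definition col_weight m n (A : 'M[int]_(m, n)) (j : 'I_n) : nat :=
  #|[set i : 'I_m | A i j != 0]|.

Definition Phi m n (A : 'M[int]_(m, n)) : Prop :=
  forall i j, A i j \in [:: 0; 1].

Definition Psi m n (A : 'M[int]_(m, n)) : Prop :=
  forall i j, A i j \in [:: 0; 1; -1].

Definition has_weights m n (h : 'I_m -> nat) (k : 'I_n -> nat)
    (A : 'M[int]_(m, n)) : Prop :=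
  (forall i, row_weight A i = h i) /\ (forall j, col_weight A j = k j).

Definition Phi_hk m n (h : 'I_m -> nat) (k : 'I_n -> nat)
    (A : 'M[int]_(m, n)) : Prop :=
  Phi A /\ has_weights h k A.

Definition Psi_hk m n (h : 'I_m -> nat) (k : 'I_n -> nat)
    (A : 'M[int]_(m, n)) : Prop :=
  Psi A /\ has_weights h k A.

Definition consecutive_ones n (v : 'I_n -> int) : Prop :=
  forall a b c : 'I_n, (a < b)%N -> (b < c)%N ->
    v a = 1 -> v c = 1 -> v b <> 0.

Definition convex m n (A : 'M[int]_(m, n)) : Prop :=
  (forall i, consecutive_ones (fun j => A i j)) /\
  (forall j, consecutive_ones (fun i => A i j)).

Definition alternating n (v : 'I_n -> int) : Prop :=
  forall a c : 'I_n, (a < c)%N -> v a != 0 -> v c != 0 ->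
    (forall b : 'I_n, (a < b)%N -> (b < c)%N -> v b = 0) ->
    Num.sg (v c) = - Num.sg (v a).

Definition NASM m n (A : 'M[int]_(m, n)) : Prop :=
  [/\ Psi A,
      forall i, alternating (fun j => A i j) &
      forall j, alternating (fun i => A i j)].

Definition NASM_hk m n (h : 'I_m -> nat) (k : 'I_n -> nat)
    (A : 'M[int]_(m, n)) : Prop :=
  NASM A /\ Psi_hk h k A.

(* Main.v *)
Require Import Defs.
From mathcomp Require Import all_boot all_order all_algebra.

(** Multiply the convex array by the checkerboard [(-1)^(i+j)]: consecutive
    nonzero entries of a row or column of a convex array are adjacent, so they
    receive opposite signs. *)

Set Implicit Arguments.
Unset Strict Implicit.
Unset Printing Implicit Defensive.

Import Order.TTheory GRing.Theory Num.Theory.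
Local Open Scope ring_scope.

(** Multiplying by signs keeps the zero pattern, hence every weight. Along a single row or column
    the checkerboard sign is [(-1) ^+ (s + j)] with [s] the fixed index, so [alternating_signed]
    settles both directions. *)

Lemma alternating_signed n (v : 'I_n -> int) (s : nat) :
  (forall j, v j \in [:: 0; 1]) -> consecutive_ones v ->
  alternating (fun j => (-1) ^+ (s + j) * v j).
Proof.
move=> v01 v_conv a c lt_ac.
have nz1 (j : 'I_n) : (-1) ^+ (s + j) * v j != 0 -> v j = 1.
  rewrite mulf_eq0 signr_eq0 /= => vj0.
  by move: (v01 j); rewrite !inE (negPf vj0) => /eqP.
move=> /nz1 va /nz1 vc between0; rewrite va vc !mulr1.
(* If [c] is beyond [a.+1], the entry at [a.+1] must vanish by [between0] yet is nonzero by
   convexity. So [c] is [a.+1], and the exponent changes parity. *)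
have [lt_ac1|le_ca1] := ltnP a.+1 c.
  pose b := Ordinal (ltn_trans lt_ac1 (ltn_ord c)).
  have /eqP := between0 b (ltnSn a) lt_ac1.
  by rewrite mulf_eq0 signr_eq0 => /eqP /(v_conv a b c (ltnSn a) lt_ac1 va vc).
have -> : nat_of_ord c = a.+1 by apply/eqP; rewrite eqn_leq le_ca1.
by rewrite addnS exprS mulN1r sgrN.
Qed.

Theorem theorem2p7 (m n : nat) (h : 'I_m -> nat) (k : 'I_n -> nat)
    (hm : (0 < m)%N) (hn : (0 < n)%N) :
  (exists A : 'M[int]_(m, n), Phi_hk h k A /\ convex A) ->
  exists B : 'M[int]_(m, n), NASM_hk h k B.
Proof.
case=> A [[A01 [Ah Ak]] [rowA colA]].
pose B : 'M[int]_(m, n) := \matrix_(i, j) ((-1) ^+ (i + j) * A i j).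
have B0 i j : (B i j != 0) = (A i j != 0).
  by rewrite mxE mulf_eq0 signr_eq0.
have PsiB : Psi B.
  move=> i j; rewrite mxE -signr_odd; move: (A01 i j); rewrite !inE.
  by case/orP => /eqP ->; case: odd.
exists B; split; split=> //.
- move=> i a c; rewrite !mxE => lt_ac Ba Bc between0.
  apply: (alternating_signed (A01 i) (rowA i) lt_ac Ba Bc) => b ab bc.
  by rewrite -(between0 b ab bc) mxE.
(* Commuting the exponent puts the fixed column index [j] in the role of [s]. *)
- move=> j a c; rewrite !mxE !(addnC _ j) => lt_ac Ba Bc between0.
  apply: (alternating_signed (A01^~ j) (colA j) lt_ac Ba Bc) => b ab bc.
  by rewrite -(between0 b ab bc) mxE addnC.
- split=> [i | j].
  + by rewrite -Ah; apply: eq_card => j; rewrite !inE B0.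
  + by rewrite -Ak; apply: eq_card => i; rewrite !inE B0.
Qed.
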